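(* Let $(\mathcal{X}, \mathcal{T}, g)$ be an $n$-dimensional indefinite metric polyhedron (not necessarily compact) with vertex set $\mathcal{V}$ and suppose that $d = \max\{\deg(v) \mid v \in \mathcal{V}\} < \infty$. Let $q = \max\{d, 2n+1\}$. Then there exists a simplicial isometric embedding of $\mathcal{X}$ into $\mathbb{R}^{p,p}$ where $p = 2q(d^3 - d^2 + d + 1)$.
   Context: An indefinite metric polyhedron is a triple $(\mathcal{X}, \mathcal{T}, g)$ where $\mathcal{X}$ is a topological space, $\mathcal{T}$ is a locally finite simplicial triangulation of $\mathcal{X}$ with vertex set $\mathcal{V}$ (which is countable) and edge set $\mathcal{E}$, and $g : \mathcal{E} \to \mathbb{R}$ is an arbitrary function. It is $n$-dimensional if $n$ is the maximal dimension of a simplex of $\mathcal{T}$. The degree $\deg(v)$ of a vertex $v$ is the number of edges of $\mathcal{T}$ incident with $v$. Minkowski space $\mathbb{R}^{p,q}$ is $\mathbb{R}^{p+q}$ endowed with the symmetric bilinear form $\langle \vec v, \vec w\rangle = \sum_{i=1}^{p} v_i w_i - \sum_{j=p+1}^{p+q} v_j w_j$. A simplicial map from $\mathcal{X}$ to $\mathbb{R}^N$ is a map that is affine (in barycentric coordinates) on each simplex of $\mathcal{T}$; it is determined by its values on $\mathcal{V}$. The signed square is $s(x) = x^2$ for $x \ge 0$ and $s(x) = -x^2$ for $x<0$; put $g^2(e) := s(g(e))$ for $e \in \mathcal{E}$. A simplicial isometric embedding of $(\mathcal{X}, \mathcal{T}, g)$ into $\mathbb{R}^{p,q}$ is a simplicial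 map $h : \mathcal{X} \to \mathbb{R}^{p,q}$ that is a topological embedding and satisfies $\langle h(v_i) - h(v_j), h(v_i) - h(v_j)\rangle = g^2(e_{ij})$ for every edge $e_{ij} \in \mathcal{E}$ with endpoints $v_i, v_j$. *)

(* Defs.v *)
From HB Require Import structures.
From mathcomp Require Import all_boot all_order all_algebra finmap.
From mathcomp Require Import all_classical all_reals all_analysis.

Set Implicit Arguments.
Unset Strict Implicit.
Unset Printing Implicit Defensive.

Import Order.TTheory GRing.Theory Num.Theory.
Import numFieldNormedType.Exports.

Local Open Scope fset_scope.
Local Open Scope classical_set_scope.
Local Open Scope ring_scope.

Section Complex.
Context (V : choiceType).

Record simplicialComplex := SimplicialComplex {
  simplices : set {fset V};
  simplex_neq0 : forall s, simplices s -> s != fset0;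
  simplex_face : forall s t,
    simplices s -> (t `<=` s)%fset -> t != fset0 -> simplices t;
  simplex_vertex : forall v, simplices [fset v]
}.

Definition edges (K : simplicialComplex) : set {fset V} :=
  [set e | simplices K e /\ #|` e| = 2%N].

Definition locally_finite (K : simplicialComplex) :=
  forall v, finite_set [set s | simplices K s /\ v \in s].

(* [fset_set] sends infinite sets to [fset0]; this does not happen here for a
   locally finite complex. *)
Definition degree (K : simplicialComplex) (v : V) : nat :=
  #|` fset_set [set e | edges K e /\ v \in e]|.

Definition is_max_degree (K : simplicialComplex) (d : nat) :=
  (exists v, degree K v = d) /\ (forall v, (degree K v <= d)%N).

Definition has_dimension (K : simplicialComplex) (n : nat) :=
  (exists2 s, simplices K s & #|` s| = n.+1) 
  /\ (forall s, simplices K s -> (#|` s| <= n.+1)%N).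

End Complex.

Section Realization.
Context (R : realType) (V : choiceType).

(* Points are given by their barycentric coordinates. Only finitely many
   coordinates vary on the closed simplex of [s], so that the topology of
   pointwise convergence induces its Euclidean topology. *)
Definition closed_simplex (s : {fset V}) : set {ptws V -> R} :=
  [set x | [/\ forall v, 0 <= x v, forall v, v \notin s -> x v = 0
             & \sum_(v <- s) x v = 1]].

Definition realization_set (K : simplicialComplex V) : set {ptws V -> R} :=
  \bigcup_(s in simplices K) closed_simplex s.

Definition realization (K : simplicialComplex V) : Type := realization_set K.

Section RealizationTopology.
Context (K : simplicialComplex V).

Definition bary (x : realization K) : V -> R := \val x.

HB.instance Definition _ := Choice.on (realization K).

(* The coherent (weak) topology: a set is open when its trace on each closed
   simplex is relatively open; [closed_simplex s], coerced to a type, carries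
   the subspace topology. *)
Definition coherent_open (U : set (realization K)) :=
  forall s, simplices K s ->
    open [set y : closed_simplex s |
            exists2 x : realization K, U x & bary x = \val y].

Let coherent_openT : coherent_open [set: realization K].
Proof.
move=> s Ks; rewrite (_ : [set _ | _] = setT); first exact: openT.
apply/seteqP; split=> // -[y ys] _ /=.
have yK : y \in realization_set K by apply/mem_set; exists s => //; exact/set_mem.
by exists (exist _ y yK).
Qed.

Let coherent_openI : setI_closed coherent_open.
Proof.
move=> A B oA oB s Ks; have := openI (oA s Ks) (oB s Ks).
congr open; apply/seteqP; split=> y /=.
  move=> [[x Ax xy] [x' Bx' xy']]; exists x => //; split=> //.
  by rewrite (_ : x = x')//; apply: val_inj; rewrite /= -[LHS]/(bary x) xy -xy'.
by move=> [x [Ax Bx] xy]; split; exists x.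
Qed.

Let coherent_open_bigU (I : Type) (f : I -> set (realization K)) :
  (forall i, coherent_open (f i)) -> coherent_open (\bigcup_i f i).
Proof.
move=> of_ s Ks.
have := @bigcup_open _ I setT
  (fun i => [set y : closed_simplex s | exists2 x, f i x & bary x = \val y])
  (fun i _ => of_ i s Ks).
congr open; apply/seteqP; split=> y /=.
  by move=> [i _ [x fx xy]]; exists x => //; exists i.
by move=> [x [i _ fx] xy]; exists i => //; exists x.
Qed.

HB.instance Definition _ := isOpenTopological.Build (realization K)
  coherent_openT coherent_openI coherent_open_bigU.

Lemma vertex_subproof (v : V) :
  ((fun w => (w == v)%:R) : {ptws V -> R}) \in realization_set K.
Proof.
apply/mem_set; exists [fset v]; first exact: simplex_vertex.
split=> [w|w|]; first exact: ler0n.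
  by rewrite inE => /negbTE ->.
by rewrite big_seq_fset1 eqxx.
Qed.

Definition vertex (v : V) : realization K :=
  exist (fun x => x \in realization_set K) _ (vertex_subproof v).

End RealizationTopology.
End Realization.

Section Maps.
Context (X Y : topologicalType).

Definition homeomorphism (f : X -> Y) :=
  [/\ bijective f, continuous f & forall U, open U -> open (f @` U)].

Definition topological_embedding (f : X -> Y) :=
  [/\ injective f, continuous f
    & forall U, open U -> exists2 W, open W & f @` U = range f `&` W].

End Maps.

Record indefMetricPolyhedron
    (R : realType) (X : topologicalType) (V : countType) :=
  IndefMetricPolyhedron {
    complex : simplicialComplex V;
    complex_locally_finite : locally_finite complex;
    triang : realization R complex -> X;
    triang_homeo : homeomorphism triang;
    edge_metric : edges complex -> R
  }.

Arguments triang {R X V} _.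
Arguments edge_metric {R X V} _.

Definition signed_square (R : realType) (x : R) : R :=
  if 0 <= x then x ^+ 2 else - x ^+ 2.

Definition minkowski_form (R : realType) (p q : nat) (v w : 'rV[R]_(p + q)) : R :=
  \sum_(i < p) v 0 (lshift q i) * w 0 (lshift q i)
  - \sum_(j < q) v 0 (rshift p j) * w 0 (rshift p j).

Section Embeddings.
Context (R : realType) (X : topologicalType) (V : countType).
Context (P : indefMetricPolyhedron R X V).

Definition at_vertex (v : V) : X := triang P (vertex R _ v).

Definition simplicial_map (N : nat) (h : X -> 'rV[R]_N) :=
  forall s, simplices (complex P) s ->
  forall x : realization R (complex P), closed_simplex s (bary x) ->
    h (triang P x) = \sum_(v <- s) bary x v *: h (at_vertex v).

Definition simplicial_isometric_embedding (p q : nat)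
    (h : X -> 'rV[R]_(p + q)) :=
  [/\ simplicial_map h,
      topological_embedding h
    & forall (e : edges (complex P)) (v w : V), \val e = [fset v; w] ->
        minkowski_form (h (at_vertex v) - h (at_vertex w))
                  (h (at_vertex v) - h (at_vertex w))
        = signed_square (edge_metric P e)].

End Embeddings.

(* Main.v *)
Require Import Defs.
From mathcomp Require Import all_boot all_order all_algebra finmap.
From mathcomp Require Import all_classical all_reals all_analysis.
From mathcomp Require Import ring zify.

(** The vectors of R^{p,p} can be written in null coordinates, as pairs
    (u, w) of vectors of R^p, in such a way that the Minkowski form of (u, w)
    becomes the dot product u . w. This decouples the two requirements: the
    u-component alone makes the map an embedding, and the w-component, which
    is then free, adjusts the lengths of the edges.

    Number the vertices injectively by natural numbers t_v, and let the
    u-component of v be the point (t_v, t_v^2, ..., t_v^p) of the moment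
    curve. At most p+1 distinct points of this curve are affinely
    independent, and two simplices of an n-dimensional complex have together
    at most 2n+2 <= p+1 vertices, so the simplicial extension is injective.
    It is a homeomorphism onto its image because its first null coordinate,
    a convex combination of the t_v, is proper: a sublevel set contains only
    finitely many vertices, hence meets only finitely many simplices of a
    locally finite complex, and each simplex is compact.

    Take as w-component of v the coefficients of degrees 1 to p of a
    polynomial Q_v of degree at most p. Pairing with a point of the moment
    curve then is evaluation of Q_v, up to its constant coefficient, and the
    form on an edge vw evaluates to D(t_v) - D(t_w) where D = Q_v - Q_w.
    Prescribing Q_v(t_v) = 0 and Q_v(t_w) = - g^2(vw)/2 for every neighbour w
    of v makes this difference equal to g^2(vw). Since v has at most d <= p
    neighbours, Lagrange interpolation provides such a Q_v. Thus every
    p >= max(d, 2n+1) works. *)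

Set Implicit Arguments.
Unset Strict Implicit.
Unset Printing Implicit Defensive.

Import Order.TTheory GRing.Theory Num.Theory.
Import numFieldNormedType.Exports.

Local Open Scope classical_set_scope.
Local Open Scope ring_scope.

(** * Interpolation and the moment curve *)

Section Interpolation.
Variables (F : fieldType) (I : eqType) (t : I -> F).
Hypothesis t_inj : injective t.

Lemma lagrange_interpolation (s : seq I) (b : I -> F) : uniq s ->
  exists2 Q : {poly F}, (size Q <= size s)%N & {in s, forall i, Q.[t i] = b i}.
Proof.
elim: s => [_|i s IH /= /andP[iNs /IH[Q sQ Qb]]].
  by exists 0; rewrite ?size_poly0.
set N : {poly F} := \prod_(x <- map t s) ('X - x%:P).
have Ni0 : N.[t i] != 0.
  rewrite -rootE root_prod_XsubC; apply: contra iNs.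
  by rewrite mem_map.
exists (Q + ((b i - Q.[t i]) / N.[t i]) *: N).
  rewrite (leq_trans (size_polyD _ _))// geq_max (leq_trans sQ)//=.
  by rewrite (leq_trans (size_scale_leq _ _))// size_prod_XsubC size_map.
move=> j; rewrite inE hornerD hornerZ => /predU1P[->|js].
  by rewrite divfK// addrC subrK.
have /eqP -> : N.[t j] == 0 by rewrite -rootE root_prod_XsubC map_f.
by rewrite mulr0 addr0 Qb.
Qed.

(** Affine independence of at most p+1 distinct points of the moment curve.
    The moments of [c] determine the sum of the [c j * Q.[t j]] for every
    polynomial [Q] of degree at most p, and the Lagrange polynomial of the
    node [i] isolates [c i]. *)
Lemma moment_curve_affine_free (p : nat) (s : seq I) (c : I -> F) :
  uniq s -> (size s <= p.+1)%N ->
  (forall k, (k <= p)%N -> \sum_(i <- s) c i * t i ^+ k = 0) ->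
  {in s, forall i, c i = 0}.
Proof.
move=> us sp c0 i si.
have [Q sQ Qb] := lagrange_interpolation (fun j => (j == i)%:R) us.
have : \sum_(j <- s) c j * Q.[t j] = 0.
  under eq_bigr do rewrite (horner_coef_wide _ (leq_trans sQ sp)) mulr_sumr.
  rewrite exchange_big big1//= => k _.
  under eq_bigr do rewrite mulrCA.
  by rewrite -mulr_sumr c0 ?mulr0// -ltnS.
rewrite (bigD1_seq i)//= big_seq_cond big1 => [|j /andP[sj ji]].
  by rewrite Qb// eqxx mulr1 addr0.
by rewrite Qb// (negbTE ji) mulr0.
Qed.

End Interpolation.

Definition moment_row (R : pzRingType) (p : nat) (x : R) : 'rV[R]_p :=
  \row_k x ^+ k.+1.

Lemma horner_moment (R : comNzRingType) (p : nat) (Q : {poly R}) (x : R) :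
  (size Q <= p.+1)%N ->
  Q.[x] = Q`_0 + \sum_(k < p) moment_row p x 0 k * Q`_k.+1.
Proof.
move=> sQ; rewrite (horner_coef_wide _ sQ) big_ord_recl expr0 mulr1.
by congr (_ + _); apply: eq_bigr => k _; rewrite mxE mulrC.
Qed.

(** * Null coordinates of Minkowski space *)

Section NullCoordinates.
Variables (R : realType) (p : nat).

(** The components are those for which [u] and [w] are the sum and the
    difference of the two halves of the vector, whose form is then
    (x + y) . (x - y). *)
Definition null_row (u w : 'rV[R]_p) : 'rV[R]_(p + p) :=
  row_mx (2^-1 *: (u + w)) (2^-1 *: (u - w)).

Lemma null_rowB u w u' w' :
  null_row u w - null_row u' w' = null_row (u - u') (w - w').
Proof.
rewrite /null_row opp_row_mx add_row_mx -!scalerBr.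
by congr (row_mx (_ *: _) (_ *: _)); rewrite !opprD ?opprK addrACA.
Qed.

Lemma minkowski_form_null_row u w :
  minkowski_form (null_row u w) (null_row u w) = \sum_(k < p) u 0 k * w 0 k.
Proof.
rewrite /minkowski_form -sumrB; apply: eq_bigr => k _.
by rewrite row_mxEl row_mxEr !mxE; field.
Qed.

Definition null_coord (k : 'I_p) (z : 'rV[R]_(p + p)) : R :=
  z 0 (lshift p k) + z 0 (rshift p k).

Lemma null_coord_null_row k u w : null_coord k (null_row u w) = u 0 k.
Proof. by rewrite /null_coord row_mxEl row_mxEr !mxE; field. Qed.

Lemma null_coord_sum k (I : Type) (s : seq I) (a : I -> R) z :
  null_coord k (\sum_(i <- s) a i *: z i) = \sum_(i <- s) a i * null_coord k (z i).
Proof.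
rewrite /null_coord !summxE -big_split/=.
by apply: eq_bigr => i _; rewrite !mxE mulrDr.
Qed.

Lemma continuous_null_coord k : continuous (null_coord k).
Proof.
move=> z; have cc i : {for z, continuous (fun z : 'rV[R]_(p + p) => z 0 i)}.
  exact: coord_continuous.
exact: (@cvgD R R^o _ _ _ _ _ _ _ (cc _) (cc _)).
Qed.

End NullCoordinates.

(** * Topology of matrices and of closed simplices *)

Lemma mx_hausdorff (T : topologicalType) m n :
  hausdorff_space T -> hausdorff_space 'M[T]_(m, n).
Proof.
move=> hT x y xy; apply/matrixP => i j; apply: hT => A B xA yB.
pose cyl C : set 'M[T]_(m, n) := [set z | C (z i j)].
have cyl_nbhs (z : 'M[T]_(m, n)) C : nbhs (z i j) C -> nbhs z (cyl C).
  move=> zC; exists (fun k l => if (k, l) == (i, j) then C else setT).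
    by move=> k l; case: eqP => [[-> ->]//|_]; exact: filterT.
  by move=> w /(_ i j); rewrite eqxx.
by have [z [zA zB]] := xy _ _ (cyl_nbhs _ _ xA) (cyl_nbhs _ _ yB); exists (z i j).
Qed.

Lemma continuous_mx (S T : topologicalType) m n (f : S -> 'M[T]_(m, n)) :
  (forall i j, continuous (fun x => f x i j)) -> continuous f.
Proof.
move=> fc x A [B xB BA]; apply: (@filterS _ _ _ _ _ BA).
apply: filter_forall => i; apply: filter_forall => j.
exact: (fc i j x _ (xB i j)).
Qed.

Lemma topological_embedding_homeo (X Y Z : topologicalType) (f : X -> Z)
    (g : X -> Y) (g' : Y -> X) :
  cancel g g' -> cancel g' g -> homeomorphism g -> topological_embedding f ->
  topological_embedding (f \o g').
Proof.
move=> gK g'K [_ gc go] [f_inj fc fo].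
have g'E (A : set Y) : g' @` A = g @^-1` A.
  apply/seteqP; split=> [_ [y Ay <-]|x Agx]; first by rewrite /= g'K.
  by exists (g x); rewrite ?gK.
have g'V (A : set X) : g' @^-1` A = g @` A.
  apply/seteqP; split=> [y Ay|_ [x Ax <-]]; last by rewrite /= gK.
  by exists (g' y); rewrite ?g'K.
split.
- exact: inj_comp f_inj (can_inj g'K).
- apply/continuousP => A oA; rewrite comp_preimage g'V; apply: go.
  exact: ((continuousP _).1 fc).
- move=> U oU.
  have imE (A : set Y) : (f \o g') @` A = f @` (g @^-1` A).
    by rewrite -[LHS](image_comp g' f) g'E.
  rewrite !imE preimage_setT; apply: fo.
  exact: ((continuousP _).1 gc).
Qed.

Section ClosedSimplex.
Variables (R : realType) (V : choiceType) (s : {fset V}).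

Lemma continuous_eval (v : V) : continuous (fun a : {ptws V -> R} => a v : R).
Proof. exact: (@proj_continuous V (fun=> R) v). Qed.

Lemma continuous_weighted_sum (c : V -> R) :
  continuous (fun a : {ptws V -> R} => \sum_(v <- s) a v * c v : R).
Proof.
apply: (@continuous_big R V +%R 0 xpredT _ {ptws V -> R}).
  exact: (@add_continuous R^o).
move=> v _ a; have av := @continuous_eval v a.
exact: (@cvgM R _ _ _ _ _ _ _ av (cvg_cst _)).
Qed.

(** Inside the space of all functions, the closed simplex is a hyperplane
    section of a product of segments, compact by the Tychonoff theorem. *)
Lemma compact_closed_simplex : compact (@closed_simplex R V s).
Proof.
pose side v : set R := if v \in s then `[0, 1]%classic else [set 0].
pose box : set {ptws V -> R} := [set a | forall v, side v (a v)].
rewrite (_ : @closed_simplex R V s =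
    box `&` [set a | \sum_(v <- s) a v * 1 = 1]); last first.
  apply/seteqP; split=> a.
    move=> [a0 as0 a1]; split=> /= [v|]; last by under eq_bigr do rewrite mulr1.
    rewrite /side; case: ifPn => [vs|/as0//]; rewrite /= in_itv/= a0/= -a1.
    by rewrite (big_fsetD1 v)//= lerDl sumr_ge0.
  move=> [ba /=]; under eq_bigr do rewrite mulr1.
  by split=> // v => [|/negbTE vs]; have := ba v; rewrite /side;
    [case: ifP => _ /=; [rewrite in_itv/= => /andP[]|move->]|rewrite vs].
apply: compact_closedI.
  apply: (@tychonoff V (fun=> R) side) => v.
  by rewrite /side; case: ifP => _; [exact: segment_compact|exact: compact_set1].
have /continuous_closedP := @continuous_weighted_sum (fun=> 1).
by move=> /(_ [set 1]); apply; exact: closed_eq.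
Qed.

Lemma closed_simplexS (u : {fset V}) (a : {ptws V -> R}) :
  (s `<=` u)%fset -> closed_simplex s a -> closed_simplex u a.
Proof.
move=> su [a0 as0 a1]; split=> // [v vu|].
  by apply: as0; apply: contra vu; exact: (fsubsetP su).
by rewrite -a1; apply/esym/big_fset_incl => // v _; exact: as0.
Qed.

End ClosedSimplex.

(** * Simplicial extension of a map on vertices *)

Section SimplicialExtension.
Variables (R : realType) (V : choiceType) (K : simplicialComplex V).
Variables (N : nat) (H : V -> 'rV[R]_N).

(** The sum over all vertices is finitely supported on the points of the
    realization; it avoids the choice of a simplex that contains the point. *)
Definition barycentric_comb (a : V -> R) : 'rV[R]_N :=
  \sum_(v \in [set: V]) a v *: H v.

Definition simplicial_extension (x : realization R K) :=
  barycentric_comb (bary x).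

Lemma barycentric_combE (s : {fset V}) (a : {ptws V -> R}) :
  closed_simplex s a -> barycentric_comb a = \sum_(v <- s) a v *: H v.
Proof.
case=> _ as0 _; rewrite /barycentric_comb (@fsbigTE _ _ _ _ s)// => v vs.
by rewrite as0// scale0r.
Qed.

Lemma bary_closed_simplex (x : realization R K) :
  exists2 s, simplices K s & closed_simplex s (bary x).
Proof. by have [s] := set_mem (valP x); exists s. Qed.

Lemma closed_simplex_bary (s : {fset V}) (a : {ptws V -> R}) :
  simplices K s -> closed_simplex s a -> exists x : realization R K, bary x = a.
Proof.
move=> Ks sa; have aK : a \in realization_set K by apply/mem_set; exists s.
by exists (exist _ a aK).
Qed.

Lemma open_realizationE (U : set (realization R K)) : open U = coherent_open U.
Proof. by []. Qed.

Lemma continuous_barycentric_sum (s : {fset V}) :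
  continuous (fun a : {ptws V -> R} => \sum_(v <- s) a v *: H v).
Proof.
apply: continuous_mx => i j.
rewrite (_ : (fun a => _) = (fun a : {ptws V -> R} => \sum_(v <- s) a v * H v i j)).
  exact: continuous_weighted_sum.
by apply/funext => a; rewrite summxE; apply: eq_bigr => v _; rewrite mxE.
Qed.

Lemma continuous_simplicial_extension : continuous simplicial_extension.
Proof.
apply/continuousP => A oA; rewrite open_realizationE => s Ks.
exists [set a : {ptws V -> R} | A (\sum_(v <- s) a v *: H v)].
  exact: ((continuousP _).1 (@continuous_barycentric_sum s) _ oA).
apply/seteqP; split=> -[y ys] /=; have sy := set_mem ys.
  rewrite set_valE/= => Ay; have [x xy] := closed_simplex_bary Ks sy.
  by exists x; rewrite // /simplicial_extension xy (barycentric_combE sy).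
rewrite set_valE/= => -[x + xy].
by rewrite /simplicial_extension xy (barycentric_combE sy).
Qed.

(** The trace of [U] on the simplex comes from an open set of functions, so
    that this image is compact. *)
Lemma closed_image_simplexD (s : {fset V}) (U : set (realization R K)) :
  simplices K s -> open U ->
  closed (simplicial_extension @` [set x | closed_simplex s (bary x) /\ ~ U x]).
Proof.
move=> Ks; rewrite open_realizationE => oU; have [G oG GU] := oU s Ks.
rewrite (_ : _ @` _ = (fun a : {ptws V -> R} => \sum_(v <- s) a v *: H v) @`
    (closed_simplex s `&` ~` G)).
  apply: compact_closed; first exact/mx_hausdorff/Rhausdorff.
  apply: continuous_compact.
    exact/continuous_subspaceT/continuous_barycentric_sum.
  by apply: compact_closedI; [exact: compact_closed_simplex|exact: open_closedC].
have GUE x : closed_simplex s (bary x) -> G (bary x) <-> U x.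
  move=> sx.
  have := congr1 (fun A => A (exist _ (bary x) (mem_set sx) : closed_simplex s)) GU.
  rewrite /= set_valE/= => ->; split=> [[y Uy yx]|]; last by exists x.
  by rewrite (_ : x = y)//; exact/esym/val_inj.
apply/seteqP; split=> z.
  case=> x [sx nUx] <-; exists (bary x); last first.
    by rewrite /simplicial_extension (barycentric_combE sx).
  by split=> // /(GUE _ sx).
case=> a [sa nGa] <-; have [x xa] := closed_simplex_bary Ks sa.
rewrite -xa in sa nGa *; exists x; last first.
  by rewrite /simplicial_extension (barycentric_combE sa).
by split=> // /(GUE _ sa).
Qed.

(** A coordinate [phi] that tends to infinity along the vertices makes the
    extension proper. The image of an open set [U] is cut out of the range as
    follows: on the open region [phi < M], only the finitely many simplices
    with a vertex in that region matter, and it suffices to remove the images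
    of their parts outside [U], which are closed. *)
Lemma simplicial_extension_embedding (phi : 'rV[R]_N -> R) :
  locally_finite K ->
  injective simplicial_extension ->
  continuous phi ->
  (forall (s : {fset V}) (a : V -> R),
    phi (\sum_(v <- s) a v *: H v) = \sum_(v <- s) a v * phi (H v)) ->
  (forall M, finite_set [set v | phi (H v) < M]) ->
  topological_embedding simplicial_extension.
Proof.
move=> Kfin ext_inj phic phiE phi_fin; split=> // [|U oU].
  exact: continuous_simplicial_extension.
pose low M := [set s | simplices K s /\ exists2 v, v \in s & phi (H v) < M].
have low_fin M : finite_set (low M).
  apply: (@sub_finite_set _ _
    (\bigcup_(v in [set v | phi (H v) < M]) [set s | simplices K s /\ v \in s])).
    by move=> s [Ks [v vs vM]]; exists v.
  by apply: bigcup_finite => // v _; exact: Kfin.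
have lowP M x s : simplices K s -> closed_simplex s (bary x) ->
    phi (simplicial_extension x) < M -> low M s.
  move=> Ks sx; rewrite /simplicial_extension (barycentric_combE sx) phiE => xM.
  split=> //; apply: contrapT => no_low.
  move: xM; rewrite ltNge => /negP; apply.
  case: sx => x0 _ x1; rewrite -[M]mul1r -x1 mulr_suml big_seq [leRHS]big_seq.
  apply: ler_sum => v vs; rewrite ler_wpM2l// leNgt; apply/negP => vM.
  by apply: no_low; exists v.
pose W M := [set z | phi z < M] `&` ~` \bigcup_(s in low M)
  simplicial_extension @` [set x | closed_simplex s (bary x) /\ ~ U x].
exists (\bigcup_M W M).
  apply: bigcup_open => M _; apply: openI.
    exact: ((continuousP phi).1 phic [set x | x < M] (@open_lt R M)).
  apply: closed_openC; apply: closed_bigcup => // s [Ks _].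
  exact: closed_image_simplexD.
apply/seteqP; split=> z.
  case=> x Ux <-; split; first by exists x.
  exists (phi (simplicial_extension x) + 1) => //.
  split; first by rewrite /= ltrDl.
  by move=> [s _ [y [_ nUy] /ext_inj yx]]; apply: nUy; rewrite yx.
case=> -[x _ <-] [M _ [xM notU]]; exists x => //; apply: contrapT => nUx.
have [s Ks sx] := bary_closed_simplex x.
by apply: notU; exists s; [exact: lowP xM|exists x].
Qed.

End SimplicialExtension.

(** Two points lie in two simplices with together at most 2n+2 vertices. The
    moments of the difference of their barycentric coordinates vanish: the
    moment of order 0 because both families of coordinates sum to 1, and those
    of orders 1 to p because the images have the same null coordinates. *)
Lemma moment_extension_inj (R : realType) (V : choiceType)
    (K : simplicialComplex V) (n p : nat) (t : V -> R) (w : V -> 'rV[R]_p) :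
  injective t ->
  (forall s, simplices K s -> (#|` s| <= n.+1)%N) -> (2 * n + 1 <= p)%N ->
  injective (simplicial_extension (K := K)
    (fun v => null_row (moment_row p (t v)) (w v))).
Proof.
move=> t_inj Kn np x y; set H := fun v => _.
have [s Ks sx] := bary_closed_simplex x; have [r Kr ry] := bary_closed_simplex y.
pose u := (s `|` r)%fset.
have ux : closed_simplex u (bary x) by apply: closed_simplexS sx; exact: fsubsetUl.
have uy : closed_simplex u (bary y) by apply: closed_simplexS ry; exact: fsubsetUr.
rewrite /simplicial_extension (barycentric_combE _ ux) (barycentric_combE _ uy).
move=> xy.
have up : (size u <= p.+1)%N.
  have : (#|` u| <= #|` s| + #|` r|)%N by rewrite cardfsU leq_subr.
  by have := Kn _ Ks; have := Kn _ Kr; lia.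
have moment0 k : (k <= p)%N ->
    \sum_(v <- u) (bary x v - bary y v) * t v ^+ k = 0.
  under eq_bigr do rewrite mulrBl.
  rewrite sumrB; case: k => [_|k kp].
    case: ux uy => _ _ x1 [_ _ y1].
    under eq_bigr do rewrite expr0 mulr1.
    under [X in _ - X]eq_bigr do rewrite expr0 mulr1.
    by rewrite x1 y1 subrr.
  have := congr1 (null_coord (Ordinal kp)) xy; rewrite !null_coord_sum.
  under eq_bigr do rewrite null_coord_null_row mxE.
  under [X in _ = X]eq_bigr do rewrite null_coord_null_row mxE.
  by move=> /= ->; rewrite subrr.
have bary0 := moment_curve_affine_free t_inj (fset_uniq u) up moment0.
apply: val_inj; apply/funext => v.
have [vu|vu] := boolP (v \in u); first by apply/eqP; rewrite -subr_eq0 bary0.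
case: ux uy => _ + _ [_ + _] => /(_ v vu) xv /(_ v vu) yv.
by rewrite [LHS]xv [RHS]yv.
Qed.

(** * Edges at a vertex *)

Section Edges.
Variables (V : choiceType) (K : simplicialComplex V).

Lemma edge_neq v w : edges K [fset v; w]%fset -> w != v.
Proof. by case=> _; rewrite cardfs2 eq_sym; case: eqP. Qed.

(** A neighbour [w] of [v] is determined by the edge [fset v; w], so there are
    no more neighbours than edges at [v]. *)
Lemma neighbours_leq_degree v : locally_finite K ->
  exists2 s : {fset V}, (#|` s| <= degree K v)%N &
    forall w, edges K [fset v; w]%fset -> w \in s.
Proof.
move=> Kfin; pose E := [set e | edges K e /\ v \in e].
pose N := [set w | edges K [fset v; w]%fset].
have Efin : finite_set E.
  by apply: sub_finite_set (Kfin v) => e [[Ke _] ve].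
have Nfin : finite_set N.
  apply: (@sub_finite_set _ _ (\bigcup_(e in E) [set` e])).
    move=> w vw; exists [fset v; w]%fset; rewrite /= ?fset22//.
    by split; rewrite ?fset21.
  by apply: bigcup_finite => // e _; exact: finite_fset.
exists (fset_set N) => [|w vw]; last by rewrite in_fset_set// inE.
have edge_inj : {in fset_set N &, injective (fun w => [fset v; w]%fset)}.
  move=> w w'; rewrite !in_fset_set// !inE => /edge_neq wv _ /fsetP/(_ w).
  by rewrite !inE eqxx (negbTE wv) /= => /esym/eqP.
rewrite -(card_in_imfset imfset_key edge_inj)/=; apply: fsubset_leq_card.
apply/fsubsetP => _ /imfsetP[w /= + ->]; rewrite !in_fset_set// !inE => vw.
by split=> //; rewrite fset21.
Qed.

End Edges.

(** * The isometric embedding *)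

Section IsometricEmbedding.
Variables (R : realType) (X : topologicalType) (V : countType).
Variable P : indefMetricPolyhedron R X V.
Let K := complex P.

(** The prescribed form g^2 on pairs of vertices, extended by 0 to the pairs
    that do not span an edge. *)
Definition squared_length (v w : V) : R :=
  oapp (fun e : edges K => signed_square (edge_metric P e)) 0
    (insub [fset v; w]%fset).

Lemma squared_lengthC v w : squared_length v w = squared_length w v.
Proof. by rewrite /squared_length fsetUC. Qed.

Lemma squared_lengthE (e : edges K) v w : \val e = [fset v; w]%fset ->
  squared_length v w = signed_square (edge_metric P e).
Proof. by rewrite /squared_length => <-; rewrite valK. Qed.

Let t (v : V) : R := (choice.pickle v)%:R.

Let t_inj : injective t.
Proof. by move=> v w /eqP; rewrite eqr_nat => /eqP/(pcan_inj choice.pickleK). Qed.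

(** The two endpoints of an edge each contribute half of its squared length;
    sharing it equally lets the polynomials of the vertices be chosen
    independently of one another. *)
Lemma edge_interpolation (v : V) : exists Q : {poly R},
  [/\ (size Q <= (degree K v).+1)%N, Q.[t v] = 0 &
      forall w, edges K [fset v; w]%fset -> Q.[t w] = - (squared_length v w / 2)].
Proof.
have [s sd sN] := neighbours_leq_degree v (@complex_locally_finite _ _ _ P).
pose b w : R := if w == v then 0 else - (squared_length v w / 2).
have [Q sQ Qb] := lagrange_interpolation t_inj b (fset_uniq (v |` s)%fset).
exists Q; split.
- rewrite (leq_trans sQ)// (leq_trans (leq_card_fsetU _ _))//.
  by rewrite cardfs1 add1n ltnS.
- by rewrite Qb ?fset1U1// /b eqxx.
- by move=> w vw; rewrite Qb ?fset1Ur ?sN// /b (negbTE (edge_neq vw)).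
Qed.

Lemma null_isometric_embedding (n d p : nat) :
  (forall s, simplices K s -> (#|` s| <= n.+1)%N) ->
  (forall v, (degree K v <= d)%N) -> (d <= p)%N -> (2 * n + 1 <= p)%N ->
  exists h : X -> 'rV[R]_(p + p), simplicial_isometric_embedding P h.
Proof.
move=> Kn Kd dp np; have [Q QP] := choice edge_interpolation.
have sQ v : (size (Q v) <= p.+1)%N.
  by have [/leq_trans-> //] := QP v; rewrite ltnS (leq_trans (Kd v)).
pose w v : 'rV[R]_p := \row_k (Q v)`_k.+1.
pose H v := null_row (moment_row p (t v)) (w v).
have [[T TK KT] _ _] := triang_homeo P.
pose h := simplicial_extension (K := K) H \o T.
have hT x : h (triang P x) = simplicial_extension H x by rewrite /h /= TK.
have hV v : h (at_vertex P v) = H v.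
  rewrite /at_vertex hT /simplicial_extension.
  rewrite (barycentric_combE _ (s := [fset v]%fset)).
    by rewrite big_seq_fset1 /bary/= eqxx scale1r.
  split=> [u|u|]; first exact: ler0n.
    by rewrite /bary/= inE => /negbTE ->.
  by rewrite big_seq_fset1 /bary/= eqxx.
exists h; split.
- move=> s Ks x sx; rewrite hT /simplicial_extension (barycentric_combE _ sx).
  by apply: eq_bigr => v _; rewrite hV.
- apply: (topological_embedding_homeo TK KT (triang_homeo P)).
  have p0 : (0 < p)%N by lia.
  apply: (simplicial_extension_embedding (phi := null_coord (Ordinal p0))).
  + exact: complex_locally_finite.
  + exact: (moment_extension_inj t_inj Kn np).
  + exact: continuous_null_coord.
  + by move=> s a; rewrite null_coord_sum.
  + move=> M; apply: (@sub_finite_set _ _ (choice.pickle @^-1` `I_(Num.truncn M).+1)).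
      move=> v /=; rewrite null_coord_null_row mxE expr1 => vM.
      by rewrite -(ltr_nat R) (lt_trans vM)// truncnS_gt.
    apply: finite_preimage => // v v' _ _.
    exact: (pcan_inj choice.pickleK).
- move=> e v v' evv'; rewrite !hV null_rowB minkowski_form_null_row.
  have vv' : edges K [fset v; v']%fset by rewrite -evv'; exact: set_mem (valP e).
  have [_ Qv Qvv'] := QP v; have [_ Qv' Qv'v] := QP v'.
  rewrite -(squared_lengthE evv').
  transitivity ((Q v - Q v').[t v] - (Q v - Q v').[t v']); last first.
    rewrite !hornerD !hornerN Qv Qv' Qvv'// Qv'v 1?fsetUC//.
    by rewrite (squared_lengthC v' v); field.
  have sD : (size (Q v - Q v')%R <= p.+1)%N.
    by rewrite (leq_trans (size_polyD _ _))// geq_max size_polyN !sQ.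
  rewrite !(horner_moment _ sD) opprD addrACA subrr add0r -sumrB.
  by apply: eq_bigr => k _; rewrite !mxE coefB; ring.
Qed.

End IsometricEmbedding.

Theorem theorem3 (R : realType) (X : topologicalType) (V : countType)
    (P : indefMetricPolyhedron R X V) (n d : nat) :
  has_dimension (complex P) n ->
  is_max_degree (complex P) d ->
  let q := maxn d (2 * n + 1) in
  let p := (2 * q * (d ^ 3 - d ^ 2 + d + 1))%N in
  exists h : X -> 'rV[R]_(p + p),
    simplicial_isometric_embedding P h.
Proof.
move=> [_ Kn] [_ Kd] q p.
have qp : (q <= p)%N.
  by rewrite /p -mulnA mulnCA leq_pmulr// muln_gt0/= addn1.
apply: null_isometric_embedding Kn Kd (leq_trans _ qp) (leq_trans _ qp).
  exact: leq_maxl.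
exact: leq_maxr.
Qed.
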